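(* Let $\alpha\in(0,1)$ and let $((P_t,X_t))_{t\in\mathbb{N}}$ be a sequence of p-values $P_t\in(0,1)$ and contextual feature vectors $X_t\in\mathcal{X}\subseteq\mathbb{R}^d$ attached to hypotheses $(H_t)_{t\in\mathbb{N}}$, where null p-values are super-uniform: $\Pr[P_t\le u]\le u$ for all $u\in[0,1]$ whenever $H_t=0$. Suppose that the p-values $(P_t)_{t\in\mathbb{N}}$ are mutually independent and that, additionally, the null p-values are independent of all the contextual features, in the sense that for every $t$ with $H_t=0$, $P_t$ is independent of the pair $\big((P_s)_{s\ne t},(X_s)_{s\in\mathbb{N}}\big)$. Then for every monotone contextual generalized alpha-investing rule (at level $\alpha$), $$\sup_{T\in\mathbb{N}}\ \mathrm{FDR}(T)\le\alpha .$$
   Context: Hypotheses: $H_t\in\{0,1\}$, with $H_t=0$ meaning null and $H_t=1$ alternative (non-null); the truth values are fixed and unknown; $\mathcal{H}^0=\{t: H_t=0\}$. No assumption is made on the marginal distribution of $P_t$ when $H_t=1$. Decisions: a testing rule produces significance levels $\alpha_t=\alpha_t(R_1,\dots,R_{t-1},X_1,\dots,X_t)\ge 0$ and decisions $R_t=\mathbf{1}\{P_t\le\alpha_t\}$ ($R_t=1$ means $H_t$ is rejected). Let $\mathcal{F}^t=\sigma(R_1,\dots,R_t)$ and $\mathcal{G}^t=\sigma(X_1,\dots,X_t)$. Let $\rho_1=\min\{i\in\mathbb{N}:\sum_{t=1}^i R_t=1\}$ be the time of the first rejection ($\rho_1=\infty$ if there is none). Contextual generalized alpha-investing (contextual GAI)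 rule at level $\alpha$: it is given by a constant $w_0$ and nonnegative functions $\alpha_t,\phi_t,\psi_t$, measurable with respect to $\sigma(\mathcal{F}^{t-1}\cup\mathcal{G}^t)$ for every $t\ge1$ (functions of $R_1,\dots,R_{t-1},X_1,\dots,X_t$), such that (i) initial wealth: $W(0)=w_0$ with $0<w_0<\alpha$; (ii) wealth update: $W(t)=W(t-1)-\phi_t+R_t\psi_t$; (iii) non-negativity: $\phi_t\le W(t-1)$; (iv) bound on reward: $\psi_t\le\min\{\phi_t+b_t,\ \phi_t/\alpha_t+b_t-1\}$, where $b_t=\alpha-w_0\mathbf{1}\{\rho_1>t-1\}$ (when $\alpha_t=0$ the quotient $\phi_t/\alpha_t$ is read as $+\infty$). The rule is monotone if for every $t$ and every fixed $(X_1,\dots,X_t)$: if $\tilde R_i\le R_i$ for all $i\le t-1$, then $\alpha_t(\tilde R_1,\dots,\tilde R_{t-1},X_1,\dots,X_t)\le\alpha_t(R_1,\dots,R_{t-1},X_1,\dots,X_t)$. False discovery rate: $R(T)=\sum_{t=1}^T R_t$, $V(T)=\sum_{t\le T,\,t\in\mathcal{H}^0}R_t$, $\mathrm{FDP}(T)=\frac{V(T)}{R(T)\vee1}$ with $a\vee b=\max\{a,b\}$, and $\mathrm{FDR}(T)=\mathbb{E}[\mathrm{FDP}(T)]$. *)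

(* Defs.v *)
(* MathComp-Analysis *)
From HB Require Import structures.
From mathcomp Require Import all_boot all_order all_algebra finmap.
From mathcomp Require Import all_classical all_reals all_analysis.

Set Implicit Arguments.
Unset Strict Implicit.
Unset Printing Implicit Defensive.

Import Order.TTheory GRing.Theory Num.Theory.
Import numFieldNormedType.Exports.

Local Open Scope classical_set_scope.
Local Open Scope ring_scope.

(* Time is 0-based: index [t : nat] stands for the (t+1)-st hypothesis.  At that
   moment a rule has seen [t] decisions and [t.+1] feature vectors.  A sum over
   the first [T] hypotheses is a sum over [t < T].  The space of feature vectors
   R^k is [k.-tuple R], whose sigma-algebra is the product one. *)

Section Rules.
Context (R : realType) (k : nat).

(* The data (w_0, alpha_t, phi_t, psi_t) of a testing rule. *)
Record rule := Rule {
  w0 : R ;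
  alpha_ : forall t, t.-tuple bool -> t.+1.-tuple (k.-tuple R) -> R ;
  phi_ : forall t, t.-tuple bool -> t.+1.-tuple (k.-tuple R) -> R ;
  psi_ : forall t, t.-tuple bool -> t.+1.-tuple (k.-tuple R) -> R }.

(* A history is a pair (past decisions, feature vectors); only its values with
   features in [calX] are meaningful. *)
Definition histories (calX : set (k.-tuple R)) (t : nat) :
    set (t.-tuple bool * t.+1.-tuple (k.-tuple R)) :=
  [set h | forall i, calX (tnth h.2 i)].

(* Measurability of a function of (R_1..R_{t-1}, X_1..X_t) defined on
   {0,1}^(t-1) x calX^t, for the trace of the product sigma-algebra, which is
   the one generated by the coordinates.  [calX] is not assumed measurable, so
   [measurable_fun] (vacuous on a nonmeasurable domain) cannot be used here. *)
Definition predictable (calX : set (k.-tuple R)) (t : nat)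
    (f : t.-tuple bool -> t.+1.-tuple (k.-tuple R) -> R) : Prop :=
  preimage_set_system (@histories calX t) (fun h => f h.1 h.2) measurable
  `<=` preimage_set_system (@histories calX t) idfun measurable.

Definition nonneg_on (calX : set (k.-tuple R)) (t : nat)
    (f : t.-tuple bool -> t.+1.-tuple (k.-tuple R) -> R) : Prop :=
  forall h, histories calX h -> 0 <= f h.1 h.2.

Definition monotone_rule (calX : set (k.-tuple R)) (A : rule) : Prop :=
  forall t (r' r : t.-tuple bool) (x : t.+1.-tuple (k.-tuple R)),
    (forall i, calX (tnth x i)) ->
    (forall i, (tnth r' i <= tnth r i)%N) ->
    alpha_ A r' x <= alpha_ A r x.

(* The run of a rule on a p-value sequence [p] and a feature sequence [x]. *)
Section Run.
Variables (A : rule) (p : nat -> R) (x : nat -> k.-tuple R).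

Definition features (t : nat) : t.+1.-tuple (k.-tuple R) :=
  [tuple x i | i < t.+1].

Fixpoint decisions (t : nat) : t.-tuple bool :=
  match t with
  | 0 => [tuple]
  | t'.+1 => [tuple of rcons (decisions t')
                (p t' <= alpha_ A (decisions t') (features t'))]
  end.

Definition alpha_run (t : nat) : R := alpha_ A (decisions t) (features t).
Definition phi_run (t : nat) : R := phi_ A (decisions t) (features t).
Definition psi_run (t : nat) : R := psi_ A (decisions t) (features t).

Definition reject (t : nat) : bool := p t <= alpha_run t.

Fixpoint wealth (t : nat) : R :=
  match t with
  | 0 => w0 A
  | t'.+1 => wealth t' - phi_run t' + (reject t')%:R * psi_run t'
  end.

Definition num_reject (T : nat) : nat := (\sum_(t < T) reject t)%N.

(* The infimum of the empty set is +oo. *)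
Definition first_rejection : \bar R :=
  ereal_inf [set i%:R%:E | i in [set i | num_reject i = 1%N]].

Definition reward_const (alpha : R) (t : nat) : R :=
  alpha - w0 A * (t%:R%:E < first_rejection)%E%:R.

(* The quotient phi_t / alpha_t is +oo when alpha_t = 0, and then only the
   first bound on the reward remains. *)
Definition gai_constraints (alpha : R) : Prop :=
  forall t,
    [/\ phi_run t <= wealth t,
        psi_run t <= phi_run t + reward_const alpha t &
        alpha_run t != 0 ->
        psi_run t <= phi_run t / alpha_run t + reward_const alpha t - 1].

Definition false_discoveries (H : nat -> bool) (T : nat) : nat :=
  (\sum_(t < T | ~~ H t) reject t)%N.

Definition fdp (H : nat -> bool) (T : nat) : R :=
  (false_discoveries H T)%:R / (maxn (num_reject T) 1)%:R.

End Run.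
End Rules.

Section Model.
Context (d : measure_display) (Omega : measurableType d) (R : realType)
  (P : probability Omega R) (k : nat).
Variables (p : nat -> {RV P >-> R}) (X : nat -> {RV P >-> k.-tuple R}).

(* The functions are given on all of {0,1}^(t-1) x calX^t, whereas the wealth and
   reward conditions only concern the realized trajectories. *)
Definition contextual_gai (calX : set (k.-tuple R)) (alpha : R)
    (A : rule R k) : Prop :=
  [/\ 0 < w0 A < alpha,
      forall t, [/\ nonneg_on calX (alpha_ A (t:=t)),
                    nonneg_on calX (phi_ A (t:=t)) &
                    nonneg_on calX (psi_ A (t:=t))],
      forall t, [/\ predictable calX (alpha_ A (t:=t)),
                    predictable calX (phi_ A (t:=t)) &
                    predictable calX (psi_ A (t:=t))] &
      forall w, gai_constraints A (p ^~ w) (X ^~ w) alpha].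

Definition mutually_independent_pvalues : Prop :=
  forall (J : {fset nat}) (B : nat -> set R),
    (forall t, measurable (B t)) ->
    P (\bigcap_(t in [set` J]) (p t @^-1` B t)) =
    (\prod_(t <- J) P (p t @^-1` B t))%E.

(* The sigma-algebra generated by ((P_s)_{s <> t}, (X_s)_s). *)
Definition sigma_others (t : nat) : set (set Omega) :=
  <<s \bigcup_(s in [set s | s <> t]) g_sigma_algebra_preimage (p s)
      `|` \bigcup_s g_sigma_algebra_preimage (X s) >>.

Definition nulls_independent_of_others (H : nat -> bool) : Prop :=
  forall t, H t = false ->
  forall E F, g_sigma_algebra_preimage (p t) E -> sigma_others t F ->
    P (E `&` F) = (P E * P F)%E.

Definition superuniform_nulls (H : nat -> bool) : Prop :=
  forall t, H t = false ->
  forall u : R, 0 <= u <= 1 -> (P [set w | (p t w <= u)%R] <= u%:E)%E.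

Definition fdr (A : rule R k) (H : nat -> bool) (T : nat) : \bar R :=
  'E_P[fun w => fdp A (p ^~ w) (X ^~ w) H T]%E.

End Model.

(* Main.v *)
Require Import Defs.
From HB Require Import structures.
From mathcomp Require Import all_boot all_order all_algebra finmap.
From mathcomp Require Import all_classical all_reals all_analysis.
From mathcomp Require Import measurable_realfun lra.

Set Implicit Arguments.
Unset Strict Implicit.
Unset Printing Implicit Defensive.

Import Order.TTheory GRing.Theory Num.Theory.
Import numFieldNormedType.Exports.

Local Open Scope classical_set_scope.
Local Open Scope ring_scope.

(** The proof is a wealth argument combined with a leave-one-out argument.

    Write R for the number of rejections up to time T, V for the number of
    false ones, R_t for the decision, alpha_t for the level and phi_t for the
    fee at time t, and f_t = phi_t / alpha_t ([fee_rate]).  The bound on the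
    reward is designed so that each step gives
      (W(t) - W(t-1)) + (false discovery at t)
        <= R_t b_t + [t null] f_t (R_t - alpha_t):
    at a null, a rejection and its reward are together worth at most b_t + f_t,
    and the fee phi_t is at least alpha_t f_t.  The b_t are alpha, except for the
    first rejection, which yields only alpha - w_0; summing, and using
    W(T) >= 0 and w_0 <= alpha, gives the pointwise inequality
    [fdp_accounting]
      V / max(R,1) + sum_null alpha_t f_t / max(R,1)
        <= alpha + sum_null R_t f_t / max(R,1).

    It remains to see that, for a null t, the expectation of
    R_t f_t / max(R,1) is at most that of alpha_t f_t / max(R,1)
    ([null_fee_le]).  The obstacle is that R depends on the p-value P_t.
    Replace P_t by 0 and let R' be the resulting number of rejections.  Then
    R' = R when R_t = 1 ([num_reject_forced]), R <= R' always because the rule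
    is monotone ([num_reject_antitone]), and alpha_t, f_t and R' are functions
    of the other p-values and of the features, hence independent of P_t.  So
      E[R_t f_t / max(R,1)] = E[1{P_t <= alpha_t} f_t / max(R',1)]
        <= E[alpha_t f_t / max(R',1)] <= E[alpha_t f_t / max(R,1)],
    the middle step being super-uniformity after integrating out P_t by
    Tonelli ([superuniform_integral]).  Although f_t is unbounded, the products
    alpha_t f_t <= phi_t <= w_0 + alpha t are bounded ([wealth_le]), so the
    two sums can be compared, and the finite one cancelled ([fdr_le]). *)

(** * Integrating out an independent super-uniform variable *)

Section IndependentPair.
Context d d1 d2 (Omega : measurableType d) (S1 : measurableType d1)
  (S2 : measurableType d2) (R : realType) (P : probability Omega R).
Variables (U : {RV P >-> S1}) (Y : {RV P >-> S2}).
Hypothesis UY_indep : forall (E : set S1) (F : set S2),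
  measurable E -> measurable F ->
  P (U @^-1` E `&` Y @^-1` F) = (P (U @^-1` E) * P (Y @^-1` F))%E.

(** Independence says exactly that the joint law agrees with the product of the
    marginal laws on rectangles, hence everywhere; Tonelli does the rest. *)
Lemma integral_indep_pair (f : S1 * S2 -> \bar R) :
  measurable_fun setT f -> (forall z, 0 <= f z)%E ->
  (\int[P]_w f (U w, Y w) =
   \int[distribution P Y]_y \int[distribution P U]_u f (u, y))%E.
Proof.
move=> mf f0.
have mUY : measurable_fun setT (fun w => (U w, Y w)).
  by apply: measurable_fun_pair; exact: measurable_funP.
pose UY : {RV P >-> (S1 * S2)%type} := mfun_Sub (mem_set mUY).
have -> : (\int[P]_w f (U w, Y w) = \int[distribution P UY]_z f z)%E.
  by rewrite ge0_integral_distribution.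
rewrite -(eq_measure_integral (distribution P UY)
  (m1 := (distribution P U \x distribution P Y)%E)); last first.
  by move=> A mA _; exact: product_measure_unique.
by rewrite fubini_tonelli2.
Qed.

End IndependentPair.

Section Freezing.
Context d d' (Omega : measurableType d) (S : measurableType d')
  (R : realType) (P : probability Omega R).
Variables (U : {RV P >-> R}) (Y : {RV P >-> S}).
Hypothesis UY_indep : forall (E : set R) (F : set S),
  measurable E -> measurable F ->
  P (U @^-1` E `&` Y @^-1` F) = (P (U @^-1` E) * P (Y @^-1` F))%E.

(** Given [Y] the threshold [a (Y w)] is a constant, and the inner integral is
    the probability that [U] is below it.  Levels above 1 are covered because a
    probability is at most 1. *)
Lemma superuniform_integral (a g : S -> R) :
  (forall u : R, 0 <= u <= 1 -> (P [set w | (U w <= u)%R] <= u%:E)%E) ->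
  measurable_fun setT a -> measurable_fun setT g ->
  (forall y, 0 <= a y) -> (forall y, 0 <= g y) ->
  (\int[P]_w ((U w <= a (Y w))%R%:R * g (Y w))%:E <=
   \int[P]_w (a (Y w) * g (Y w))%:E)%E.
Proof.
move=> Usu ma mg a0 g0.
pose f (z : R * S) : \bar R := ((z.1 <= a z.2)%R%:R * g z.2)%:E.
have mf : measurable_fun setT f.
  apply/measurable_EFinP; apply: measurable_funM; last first.
    exact: measurableT_comp mg measurable_snd.
  apply: (measurableT_comp (f := fun b : bool => b%:R : R)) => //.
  apply: measurable_fun_ler => //.
  exact: measurableT_comp ma measurable_snd.
have f0 z : (0 <= f z)%E by rewrite lee_fin mulr_ge0.
have mag : measurable_fun setT (fun y => (a y * g y)%:E).
  by apply/measurable_EFinP; exact: measurable_funM.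
have ag0 y : (0 <= (a y * g y)%:E)%E by rewrite lee_fin mulr_ge0.
rewrite (integral_indep_pair UY_indep mf f0).
rewrite -(ge0_integral_distribution _ mag)//.
apply: ge0_le_integral => //.
- by move=> y _; exact: integral_ge0.
- exact: measurable_fun_fubini_tonelli_G.
move=> y _; rewrite /f/= mulrC.
have mle : measurable [set u : R | u <= a y].
  by rewrite -set_itvNyc; exact: measurable_itv.
rewrite (eq_integral (fun u => (g y)%:E * (\1_[set u | u <= a y] u)%:E)%E).
  rewrite ge0_integralZl_EFin//; last first.
    by apply/measurable_EFinP; exact: measurable_indic.
  rewrite integral_indic// setIT EFinM lee_wpmul2l ?lee_fin//.
  have [a1|/ltW a1] := leP (a y) 1; first by apply: Usu; rewrite a0.
  by rewrite (le_trans (probability_le1 _ _))// lee_fin.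
move=> u _; rewrite EFinM muleC indicE; congr (_%:E * _)%E.
by rewrite mem_setE.
Qed.

End Freezing.

(** * Wealth accounting along one trajectory *)

Section Accounting.
Context (R : realType) (k : nat).
Variables (A : rule R k) (p : nat -> R) (x : nat -> k.-tuple R) (alpha : R)
  (H : nat -> bool).

Local Notation reject := (reject A p x).
Local Notation num_reject := (num_reject A p x).
Local Notation wealth := (wealth A p x).
Local Notation alpha_run := (alpha_run A p x).
Local Notation phi_run := (phi_run A p x).
Local Notation psi_run := (psi_run A p x).
Local Notation fdiscoveries := (false_discoveries A p x H).

(** At level 0 the inverse is 0, and so is the fee rate: the null term
    [(alpha_t - R_t) * fee_rate t] then vanishes, as it should since a positive
    p-value is never rejected at level 0. *)
Definition fee_rate (t : nat) : R := phi_run t / alpha_run t.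

Lemma num_rejectS t : num_reject t.+1 = (num_reject t + reject t)%N.
Proof. by rewrite /Defs.num_reject big_ord_recr. Qed.

Lemma false_discoveriesS t :
  fdiscoveries t.+1 = (fdiscoveries t + ~~ H t && reject t)%N.
Proof.
rewrite /false_discoveries !(big_mkcond (fun i : 'I__ => ~~ H i)) big_ord_recr.
by case: (H t).
Qed.

Lemma num_reject_le s t : (s <= t)%N -> (num_reject s <= num_reject t)%N.
Proof.
move=> /subnK <-; elim: (t - s)%N => // n IH.
by rewrite addSn num_rejectS (leq_trans IH)// leq_addr.
Qed.

(** The number of rejections grows by steps of one, so it takes the value 1
    as soon as it is positive. *)
Lemma lt_first_rejection t :
  (t%:R%:E < first_rejection A p x)%E = (num_reject t == 0).
Proof.
apply/idP/eqP => [tlt|t0].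
  apply/eqP; rewrite -leqn0 leqNgt; apply/negP => Rt.
  suff [i it i1] : exists2 i, (i <= t)%N & num_reject i = 1%N.
    have : (first_rejection A p x <= i%:R%:E)%E.
      by apply: ereal_inf_lbound; exists i.
    by rewrite leNgt (le_lt_trans _ tlt)// lee_fin ler_nat.
  elim: t Rt {tlt} => [|t IH]; first by rewrite /Defs.num_reject big_ord0.
  case: (posnP (num_reject t)) => [t0|/IH[i it i1] _]; last first.
    by exists i => //; exact: leqW.
  rewrite num_rejectS t0 add0n lt0b => rt.
  by exists t.+1 => //; rewrite num_rejectS t0 rt.
rewrite (@lt_le_trans _ _ t.+1%:R%:E)// ?lte_fin ?ltr_nat//.
apply: le_ereal_inf_tmp => _ [i /= i1 <-]; rewrite lee_fin ler_nat ltnNge.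
by apply/negP => /num_reject_le; rewrite t0 i1.
Qed.

Hypothesis gai : gai_constraints A p x alpha.
Hypothesis w0_ge0 : 0 <= w0 A.
Hypothesis phi_ge0 : forall t, 0 <= phi_run t.

(** A trajectory wins at most [alpha] per step.  Since fees cannot exceed the
    wealth, this makes them bounded, hence integrable. *)
Lemma wealth_le t : 0 <= alpha -> wealth t <= w0 A + alpha * t%:R.
Proof.
move=> alpha_ge0; elim: t => [|t IH] /=; first by rewrite mulr0 addr0.
have [_ psi_le _] := gai t; rewrite /reward_const in psi_le.
have b0 : 0 <= w0 A * (t%:R%:E < first_rejection A p x)%E%:R.
  by rewrite mulr_ge0.
rewrite -natr1 mulrDr mulr1; have := phi_ge0 t.
by move: alpha_ge0; case: (Defs.reject _ _ _ _) => ? ?;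
  rewrite ?mul1r ?mul0r; lra.
Qed.

Lemma wealth_ge0 t : (forall s, 0 <= psi_run s) -> 0 <= wealth t.
Proof.
move=> psi_ge0; case: t => [|t] //=.
have [phi_le _ _] := gai t.
by rewrite addr_ge0 ?mulr_ge0// subr_ge0.
Qed.

Lemma alpha_fee_rate_le t : alpha_run t * fee_rate t <= phi_run t.
Proof.
rewrite /fee_rate; have [->|a0] := eqVneq (alpha_run t) 0.
  by rewrite mul0r.
by rewrite mulrCA divff// mulr1.
Qed.

(** The two bounds on the reward serve the two kinds of hypotheses: the first
    one is used when the rejected hypothesis is an alternative, and the second
    one when it is a null.  On the right-hand side the rewards [b_t] are
    summed: [alpha] per rejection, except that [w0] is lost at the first. *)
Lemma wealth_accounting T : (forall t, 0 < p t) ->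
  wealth T + (fdiscoveries T)%:R
    + \sum_(t < T | ~~ H t) (alpha_run t - (reject t)%:R) * fee_rate t
  <= w0 A * (num_reject T == 0%N)%:R + alpha * (num_reject T)%:R.
Proof.
move=> p_gt0; elim: T => [|T IH].
  by rewrite /false_discoveries /Defs.num_reject !big_ord0 /=; lra.
have [_ psi1 psi2] := gai T.
rewrite /reward_const lt_first_rejection in psi1 psi2.
rewrite false_discoveriesS num_rejectS natrD addn_eq0 /=.
have -> : \sum_(t < T.+1 | ~~ H t) (alpha_run t - (reject t)%:R) * fee_rate t =
    \sum_(t < T | ~~ H t) (alpha_run t - (reject t)%:R) * fee_rate t
    + (~~ H T)%:R * ((alpha_run T - (reject T)%:R) * fee_rate T).
  rewrite !(big_mkcond (fun i : 'I__ => ~~ H i)) big_ord_recr /=.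
  by case: (H T); rewrite ?mul0r ?mul1r.
have := alpha_fee_rate_le T; have := phi_ge0 T.
case: (boolP (reject T)) => [rT|_] /= phi0 fee.
  have a_gt0 : 0 < alpha_run T by rewrite (lt_le_trans (p_gt0 T)).
  have {}psi2 := psi2 (lt0r_neq0 a_gt0).
  have feeE : alpha_run T * fee_rate T = phi_run T.
    by rewrite /fee_rate mulrCA divff ?lt0r_neq0// mulr1.
  rewrite -/(fee_rate T) in psi2.
  rewrite natrD mulrDr andbF /= mulr0 add0r mulrBl feeE.
  by case: (H T); case: (num_reject T == 0%N) IH psi1 psi2 => /=; lra.
rewrite andbT andbF addn0 addr0 subr0.
by case: (H T) => /=; lra.
Qed.

Lemma fdp_accounting T : (forall t, 0 < p t) -> (forall s, 0 <= psi_run s) ->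
  w0 A <= alpha ->
  fdp A p x H T
    + \sum_(t < T | ~~ H t)
        alpha_run t * (fee_rate t / (maxn (num_reject T) 1)%:R)
  <= alpha + \sum_(t < T | ~~ H t)
        (reject t)%:R * (fee_rate t / (maxn (num_reject T) 1)%:R).
Proof.
move=> p_gt0 psi_ge0 w0_le.
have := wealth_accounting T p_gt0; have := @wealth_ge0 T psi_ge0.
set N := maxn _ _; have N_gt0 : 0 < N%:R :> R by rewrite ltr0n leq_max orbT.
move=> W0 acc.
under eq_bigr do rewrite mulrA; rewrite -mulr_suml.
under [in X in _ <= _ + X]eq_bigr do rewrite mulrA; rewrite -mulr_suml.
rewrite /fdp -/N -mulrDl -lerBlDr -mulrBl ler_pdivrMr//.
move: acc; under eq_bigr do rewrite mulrBl.
rewrite sumrB => acc.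
suff : w0 A * (num_reject T == 0%N)%:R + alpha * (num_reject T)%:R
    <= alpha * N%:R by lra.
(* Without any rejection the bound is [w0 <= alpha], as [N] is 1. *)
rewrite /N; case: (num_reject T) => [|n] /=.
  by rewrite mulr1 mulr0 addr0 mulr1.
by rewrite mulr0 add0r (maxn_idPl _).
Qed.

End Accounting.

(** * Comparing runs on two p-value sequences *)

Section Coupling.
Context (R : realType) (k : nat).
Variables (A : rule R k) (x : nat -> k.-tuple R).

Lemma decisions_prefix (p q : nat -> R) t :
  (forall s, (s < t)%N -> p s = q s) -> decisions A p x t = decisions A q x t.
Proof.
elim: t => [//|t IH] pq /=; rewrite IH ?pq// => s st.
by apply: pq; rewrite ltnS ltnW.
Qed.

(** Smaller p-values give more rejections so far, hence larger levels by
    monotonicity, hence again more rejections: the comparison of the whole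
    histories goes by induction on time. *)
Lemma num_reject_antitone (calX : set (k.-tuple R)) (p q : nat -> R) T :
  monotone_rule calX A -> (forall s, calX (x s)) -> (forall s, q s <= p s) ->
  (num_reject A p x T <= num_reject A q x T)%N.
Proof.
move=> Amono xX qp.
have alphaE t : (forall i, (tnth (decisions A p x t) i
    <= tnth (decisions A q x t) i)%N) ->
    (reject A p x t <= reject A q x t)%N.
  move=> dec; case: (boolP (reject A p x t)) => // pt.
  suff -> : reject A q x t by [].
  apply: le_trans (qp t) (le_trans pt _).
  by apply: (Amono _ _ _ _ _ dec) => i; rewrite tnth_mktuple; exact: xX.
apply: leq_sum => i _; apply: (alphaE).
elim: (i : nat) => [|t IH] j; first by case: j.
rewrite !(tnth_nth false) /= !nth_rcons !size_tuple.
have [jt|_] := ltnP j t.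
  by have := IH (Ordinal jt); rewrite !(tnth_nth false).
by case: eqP => // _; exact: alphaE.
Qed.

(** The value 0 is rejected at every nonnegative level. *)
Definition force_rejection (t : nat) (p : nat -> R) : nat -> R :=
  fun s => if s == t then 0 else p s.

(** A rule sees p-values only through its decisions, so changing a p-value
    without changing its decision leaves the entire run unchanged. *)
Lemma num_reject_forced (p : nat -> R) t T :
  0 <= alpha_run A p x t -> reject A p x t ->
  num_reject A (force_rejection t p) x T = num_reject A p x T.
Proof.
move=> a0 rt.
have decE s : decisions A (force_rejection t p) x s = decisions A p x s.
  elim: s => [//|s IH] /=; rewrite IH /force_rejection.
  have [->|//] := eqVneq s t; apply/val_inj; congr (rcons _ _).
  by move: rt; rewrite /reject /alpha_run in a0 *; rewrite a0 => ->.
apply: eq_bigr => i _; congr nat_of_bool.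
rewrite /reject /alpha_run decE /force_rejection.
have [->|//] := eqVneq (i : nat) t.
by move: rt; rewrite /reject /alpha_run in a0 *; rewrite a0 => ->.
Qed.

Lemma alpha_run_forced (p : nat -> R) t :
  alpha_run A (force_rejection t p) x t = alpha_run A p x t.
Proof.
rewrite /alpha_run; congr (alpha_ _ _ _); apply: decisions_prefix => s st.
by rewrite /force_rejection ltn_eqF.
Qed.

Lemma fee_rate_forced (p : nat -> R) t :
  fee_rate A (force_rejection t p) x t = fee_rate A p x t.
Proof.
rewrite /fee_rate alpha_run_forced; congr (_ / _).
rewrite /phi_run; congr (phi_ _ _ _); apply: decisions_prefix => s st.
by rewrite /force_rejection ltn_eqF.
Qed.

End Coupling.

(** * Measurability of a run *)

(** The space [S] is arbitrary because the runs are studied both on the whole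
    probability space and for the sigma-algebra generated by all the data other
    than one p-value. *)
Section RunMeasurability.
Context d (S : measurableType d) (R : realType) (k : nat).
Variables (calX : set (k.-tuple R)) (A : rule R k).
Variables (p : nat -> S -> R) (X : nat -> S -> k.-tuple R).
Hypothesis mp : forall t, measurable_fun setT (p t).
Hypothesis mX : forall t, measurable_fun setT (X t).
Hypothesis X_calX : forall t w, calX (X t w).
Hypothesis alpha_pred : forall t, predictable calX (alpha_ A (t:=t)).
Hypothesis phi_pred : forall t, predictable calX (phi_ A (t:=t)).
Hypothesis alpha_ge0 : forall t, nonneg_on calX (alpha_ A (t:=t)).

Lemma histories_run t (b : t.-tuple bool) w :
  histories calX (b, features (X ^~ w) t).
Proof. by move=> i; rewrite tnth_mktuple. Qed.

Lemma measurable_features t :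
  measurable_fun setT (fun w => features (X ^~ w) t).
Proof.
apply/measurable_fun_tnthP => i.
rewrite (_ : _ \o _ = X i)//.
by apply/funext => w; rewrite /= tnth_mktuple.
Qed.

(** Features always lie in [calX], so a trace of a measurable set on the
    histories pulls back to the same event as the measurable set itself. *)
Lemma measurable_predictable t f (b : S -> t.-tuple bool) :
  predictable calX f -> measurable_fun setT b ->
  measurable_fun setT (fun w => f (b w) (features (X ^~ w) t)).
Proof.
move=> fpred mb _ B mB.
have [M mM fM] := fpred _ (ex_intro2 _ _ B mB erefl).
have mbX : measurable_fun setT (fun w => (b w, features (X ^~ w) t)).
  by apply: measurable_fun_pair => //; exact: measurable_features.
rewrite (_ : _ `&` _ = setT `&` (fun w => (b w, features (X ^~ w) t)) @^-1` M).
  exact: mbX.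
rewrite !setTI; apply/seteqP; split => w /= hw.
  suff [] : (histories calX (t:=t) `&` idfun @^-1` M)
    (b w, features (X ^~ w) t) by [].
  by rewrite fM; split => //; exact: histories_run.
suff [] : (histories calX (t:=t) `&` (fun h => f h.1 h.2) @^-1` B)
  (b w, features (X ^~ w) t) by [].
by rewrite -fM; split => //; exact: histories_run.
Qed.

Lemma measurable_decisions t :
  measurable_fun setT (fun w => decisions A (p ^~ w) (X ^~ w) t).
Proof.
elim: t => [|t IH]; first exact: measurable_cst.
apply/measurable_fun_tnthP => i.
have [it|it] := ltnP i t.
  rewrite (_ : _ \o _ = (fun b => tnth b (Ordinal it)) \o
    (fun w => decisions A (p ^~ w) (X ^~ w) t)).
    by apply: measurableT_comp => //; exact: measurable_tnth.
  apply/funext => w.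
  by rewrite /= !(tnth_nth false) /= nth_rcons size_tuple it.
have -> : i = ord_max.
  by apply/val_inj/eqP; rewrite eqn_leq /= it andbT -ltnS ltn_ord.
rewrite (_ : _ \o _ = fun w => p t w <=
    alpha_ A (decisions A (p ^~ w) (X ^~ w) t) (features (X ^~ w) t)).
  apply: measurable_fun_ler => //.
  exact: (measurable_predictable (@alpha_pred t) IH).
apply/funext => w.
by rewrite /= !(tnth_nth false) /= nth_rcons size_tuple ltnn eqxx.
Qed.

Lemma measurable_alpha_run t :
  measurable_fun setT (fun w => alpha_run A (p ^~ w) (X ^~ w) t).
Proof.
exact: measurable_predictable (@alpha_pred t) (@measurable_decisions t).
Qed.

Lemma measurable_phi_run t :
  measurable_fun setT (fun w => phi_run A (p ^~ w) (X ^~ w) t).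
Proof.
exact: measurable_predictable (@phi_pred t) (@measurable_decisions t).
Qed.

Lemma measurable_fee_rate t :
  measurable_fun setT (fun w => fee_rate A (p ^~ w) (X ^~ w) t).
Proof.
apply: measurable_funM; first exact: measurable_phi_run.
(* On nonnegative reals the inverse is the power function of exponent -1. *)
rewrite [X in measurable_fun _ X](_ : _ =
    (fun a => a `^ (-1)) \o (fun w => alpha_run A (p ^~ w) (X ^~ w) t)).
  apply: (measurableT_comp _ (@measurable_alpha_run t)).
  exact: measurable_powR.
apply/funext => w; rewrite /= powR_inv1//.
exact: alpha_ge0 (histories_run _ _).
Qed.

Lemma measurable_reject t :
  measurable_fun setT (fun w => reject A (p ^~ w) (X ^~ w) t).
Proof. by apply: measurable_fun_ler => //; exact: measurable_alpha_run. Qed.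

Lemma measurable_count_reject (Q : pred nat) T :
  measurable_fun setT
    (fun w => \sum_(t < T | Q t) reject A (p ^~ w) (X ^~ w) t)%N.
Proof.
under eq_fun do rewrite big_mkcond.
elim: T => [|T IH].
  by under eq_fun do rewrite big_ord0; exact: measurable_cst.
under eq_fun do rewrite big_ord_recr.
apply: measurable_fun_addn => //=; case: (Q T) => //.
exact: (measurableT_comp (f := nat_of_bool)) (@measurable_reject T).
Qed.

End RunMeasurability.

(** * Expected fees of null hypotheses, and the false discovery rate *)

Section Expectation.
Context (d : measure_display) (Omega : measurableType d)
  (R : realType) (P : probability Omega R) (k : nat).
Variables (calX : set (k.-tuple R)) (alpha : R) (H : nat -> bool)
  (p : nat -> {RV P >-> R}) (X : nat -> {RV P >-> k.-tuple R}) (A : rule R k).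
Hypothesis alpha_ge0 : 0 <= alpha.
Hypothesis p_gt0 : forall t w, 0 < p t w.
Hypothesis X_calX : forall t w, calX (X t w).
Hypothesis p_null : superuniform_nulls p H.
Hypothesis pX_indep : nulls_independent_of_others p X H.
Hypothesis A_gai : contextual_gai p X calX alpha A.
Hypothesis A_mono : monotone_rule calX A.

Let alpha_pred t : predictable calX (alpha_ A (t:=t)).
Proof. by have [_ _ pred _] := A_gai; have [] := pred t. Qed.

Let phi_pred t : predictable calX (phi_ A (t:=t)).
Proof. by have [_ _ pred _] := A_gai; have [] := pred t. Qed.

Let alpha_nonneg t : nonneg_on calX (alpha_ A (t:=t)).
Proof. by have [_ nonneg _ _] := A_gai; have [] := nonneg t. Qed.

Let gai w : gai_constraints A (p ^~ w) (X ^~ w) alpha.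
Proof. by have [_ _ _] := A_gai; exact. Qed.

Let w0_ge0 : 0 <= w0 A.
Proof. by have [/andP[/ltW]] := A_gai. Qed.

Let w0_le : w0 A <= alpha.
Proof. by have [/andP[_ /ltW]] := A_gai. Qed.

Let alpha_run_ge0 q t w : 0 <= alpha_run A q (X ^~ w) t.
Proof.
have [_ nonneg _ _] := A_gai; have [nn _ _] := nonneg t.
exact: (nn (_, _) (histories_run X_calX _ _)).
Qed.

Let phi_run_ge0 q t w : 0 <= phi_run A q (X ^~ w) t.
Proof.
have [_ nonneg _ _] := A_gai; have [_ nn _] := nonneg t.
exact: (nn (_, _) (histories_run X_calX _ _)).
Qed.

Let psi_run_ge0 q t w : 0 <= psi_run A q (X ^~ w) t.
Proof.
have [_ nonneg _ _] := A_gai; have [_ _ nn] := nonneg t.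
exact: (nn (_, _) (histories_run X_calX _ _)).
Qed.

Let fee_rate_ge0 q t w : 0 <= fee_rate A q (X ^~ w) t.
Proof. by rewrite divr_ge0. Qed.

(** A rejection at [t] contributes [fee_rate t] to the budget for false
    discoveries; this is its share per rejection made up to [T]. *)
Definition shared_fee (q : nat -> R) (w : Omega) (T t : nat) : R :=
  fee_rate A q (X ^~ w) t / (maxn (num_reject A q (X ^~ w) T) 1)%:R.

Let shared_fee_ge0 q w T t : 0 <= shared_fee q w T t.
Proof. by rewrite divr_ge0. Qed.

(** The p-values and the features are read from separate sources, so as to cover
    p-values modified by forcing a rejection, and coarser sigma-algebras. *)
Lemma measurable_shared_fee d' (S : measurableType d') (q : nat -> S -> R)
    (Y : S -> Omega) T t :
  (forall s, measurable_fun setT (q s)) ->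
  (forall s, measurable_fun setT (X s \o Y)) ->
  measurable_fun setT (fun y => shared_fee (q ^~ y) (Y y) T t).
Proof.
move=> mq mX; apply: measurable_funM.
  exact: (measurable_fee_rate mq mX (fun s y => X_calX s (Y y))).
apply: (measurableT_comp (f := fun n : nat => (maxn n 1)%:R^-1 : R)) => //.
exact: (measurable_count_reject mq mX (fun s y => X_calX s (Y y))
  alpha_pred xpredT).
Qed.

Let others t := \bigcup_(s in [set s | s <> t]) g_sigma_algebra_preimage (p s)
  `|` \bigcup_s g_sigma_algebra_preimage (X s).

Lemma measurable_others_id t :
  measurable_fun setT (id : Omega -> g_sigma_algebraType (others t)).
Proof.
move=> _ F mF; rewrite setTI preimage_id.
apply: (smallest_sub (@sigma_algebra_measurable _ Omega)) mF.
by move=> G [[s _]|[s _]] [B mB <-]; exact: measurable_funP.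
Qed.

(** The leave-one-out step.  With a rejection forced at [t], the level, the fee
    rate and the number of rejections no longer involve the p-value at [t], so
    this p-value can be integrated out; and forcing a rejection can only
    increase the denominator. *)
Lemma null_fee_le t T : H t = false ->
  (\int[P]_w ((reject A (p ^~ w) (X ^~ w) t)%:R
      * shared_fee (p ^~ w) w T t)%:E <=
   \int[P]_w (alpha_run A (p ^~ w) (X ^~ w) t
      * shared_fee (p ^~ w) w T t)%:E)%E.
Proof.
move=> Ht.
pose S := g_sigma_algebraType (others t).
pose Y : {RV P >-> S} := mfun_Sub (mem_set (@measurable_others_id t)).
pose q s (y : S) : R := force_rejection t (p ^~ y) s.
have mq s : measurable_fun setT (q s).
  rewrite /q /force_rejection; have [_|/eqP st] := eqVneq s t => //.
  move=> _ B mB; apply: sub_sigma_algebra; left; exists s => //.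
  by exists B.
have mX s : measurable_fun setT (X s : S -> _).
  by move=> _ B mB; apply: sub_sigma_algebra; right; exists s => //; exists B.
have indep (E : set R) (F : set S) : measurable E -> measurable F ->
    P (p t @^-1` E `&` Y @^-1` F) = (P (p t @^-1` E) * P (Y @^-1` F))%E.
  move=> mE mF; apply: (pX_indep Ht) => //.
  by exists E => //; rewrite setTI.
(* The shares agree where [t] is rejected, and elsewhere their factor is 0. *)
have -> : (\int[P]_w ((reject A (p ^~ w) (X ^~ w) t)%:R
      * shared_fee (p ^~ w) w T t)%:E =
    \int[P]_w (((p t w <= alpha_run A (q ^~ (Y w)) (X ^~ (Y w)) t)%R)%:R
      * shared_fee (q ^~ (Y w)) (Y w) T t)%:E)%E.
  apply: eq_integral => w _; congr (_%:E).
  rewrite /= /q alpha_run_forced -/(reject A _ _ _).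
  case: (boolP (reject A (p ^~ w) (X ^~ w) t)) => rt; last by rewrite !mul0r.
  by rewrite /shared_fee fee_rate_forced num_reject_forced.
apply: (@le_trans _ _ (\int[P]_w (alpha_run A (q ^~ (Y w)) (X ^~ (Y w)) t
      * shared_fee (q ^~ (Y w)) (Y w) T t)%:E)%E).
  apply: (superuniform_integral indep
    (a := fun y : S => alpha_run A (q ^~ y) (X ^~ y) t)
    (g := fun y : S => shared_fee (q ^~ y) y T t)) => //.
  - exact: p_null.
  - exact: (measurable_alpha_run mq mX X_calX).
  - exact: (measurable_shared_fee _ _ mq mX).
have mqO s : measurable_fun setT (q s : Omega -> R).
  by rewrite /q /force_rejection; case: eqP => // _.
have mXO s : measurable_fun setT (X s) by exact: measurable_funP.
have mpO s : measurable_fun setT (p s) by exact: measurable_funP.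
apply: ge0_le_integral => //.
- by move=> w _; rewrite lee_fin mulr_ge0.
- apply/measurable_EFinP; apply: measurable_funM.
    exact: (measurable_alpha_run mqO mXO X_calX).
  exact: (measurable_shared_fee (Y := id) _ _ mqO mXO).
- apply/measurable_EFinP; apply: measurable_funM.
    exact: (measurable_alpha_run mpO mXO X_calX).
  exact: (measurable_shared_fee (Y := id) _ _ mpO mXO).
move=> w _; rewrite lee_fin /q alpha_run_forced ler_wpM2l//.
rewrite /shared_fee fee_rate_forced ler_wpM2l//.
rewrite lef_pV2 ?posrE ?ltr0n ?leq_max ?orbT// ler_nat.
rewrite geq_max leq_max leq_max leqnn orbT andbT.
apply/orP; left; apply: (num_reject_antitone _ A_mono) => // s.
by rewrite /force_rejection; case: eqP => // _; exact: ltW.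
Qed.

(** The fee rates are unbounded in general, so no difference is integrated:
    the accounting is kept as an inequality between nonnegative functions, and
    the sum of the expected fees [alpha_t * fee_rate t], which is finite, is
    cancelled after integration. *)
Lemma fdr_le T : (fdr p X A H T <= alpha%:E)%E.
Proof.
have mp s : measurable_fun setT (p s) by exact: measurable_funP.
have mX s : measurable_fun setT (X s) by exact: measurable_funP.
pose null := [seq t : 'I_T <- index_enum 'I_T | ~~ H t].
pose a (t : 'I_T) w :=
  alpha_run A (p ^~ w) (X ^~ w) t * shared_fee (p ^~ w) w T t.
pose u (t : 'I_T) w :=
  (reject A (p ^~ w) (X ^~ w) t)%:R * shared_fee (p ^~ w) w T t.
have mfee t := measurable_shared_fee (Y := id) T t mp mX.
have ma t : measurable_fun setT (EFin \o a t).
  apply/measurable_EFinP; apply: measurable_funM => //.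
  exact: (measurable_alpha_run mp mX X_calX).
have mu t : measurable_fun setT (EFin \o u t).
  apply/measurable_EFinP; apply: measurable_funM => //.
  apply: (measurableT_comp (f := fun b : bool => b%:R : R)) => //.
  exact: (measurable_reject mp mX X_calX).
have a0 t w : (0 <= (a t w)%:E)%E by rewrite lee_fin mulr_ge0.
have u0 t w : (0 <= (u t w)%:E)%E by rewrite lee_fin mulr_ge0.
have mfdp : measurable_fun setT (fun w => (fdp A (p ^~ w) (X ^~ w) H T)%:E).
  apply/measurable_EFinP; apply: measurable_funM.
    apply: (measurableT_comp (f := fun n : nat => n%:R : R)) => //.
    exact: (measurable_count_reject mp mX X_calX alpha_pred (fun t => ~~ H t)).
  apply: (measurableT_comp (f := fun n : nat => (maxn n 1)%:R^-1 : R)) => //.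
  exact: (measurable_count_reject mp mX X_calX alpha_pred xpredT).
have fdp0 w : (0 <= (fdp A (p ^~ w) (X ^~ w) H T)%:E)%E.
  by rewrite lee_fin divr_ge0.
have a_fin t : (\int[P]_w (a t w)%:E \is a fin_num)%E.
  rewrite ge0_fin_numE; last exact: integral_ge0.
  apply: (@le_lt_trans _ _ (\int[P]_w (w0 A + alpha * t%:R)%:E)%E); last first.
    by rewrite integral_cst//= probability_setT mule1 ltry.
  apply: ge0_le_integral; [by []|by []|exact: ma|exact: measurable_cst|].
  move=> w _; rewrite lee_fin.
  have [phi_le _ _] := gai w t.
  apply: le_trans (le_trans phi_le (wealth_le (gai w) _ _ _ _)) => //.
  apply: le_trans (alpha_fee_rate_le _ _).
    rewrite /a ler_wpM2l// ler_pdivrMr ?ltr0n ?leq_max ?orbT//.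
    by rewrite ler_peMr// ler1n leq_max orbT.
  by move=> s; exact: phi_run_ge0.
have sum_fin : (\sum_(t <- null) \int[P]_w (a t w)%:E \is a fin_num)%E.
  by apply/sum_fin_numP => t _ _.
rewrite -(leeD2rE _ _ sum_fin) /fdr unlock -ge0_integral_sum// -ge0_integralD//;
  [|by move=> w _; exact: sume_ge0|exact: emeasurable_sum].
apply: (@le_trans _ _
    (\int[P]_w (alpha%:E + \sum_(t <- null) (u t w)%:E))%E).
  apply: ge0_le_integral => //.
  - by move=> w _; rewrite adde_ge0// sume_ge0.
  - by apply: emeasurable_funD => //; exact: emeasurable_sum.
  - by apply: emeasurable_funD => //; exact: emeasurable_sum.
  move=> w _; rewrite !sumEFin -!EFinD lee_fin !big_filter.
  exact: (fdp_accounting H (gai w)).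
rewrite ge0_integralD//; last 2 first.
  by move=> w _; exact: sume_ge0.
  exact: emeasurable_sum.
rewrite integral_cst//= probability_setT mule1 leeD2l//.
rewrite !ge0_integral_sum// /null !big_filter.
apply: lee_sum => t /negPf Ht; exact: null_fee_le.
Qed.

End Expectation.


Theorem theorem1 (d : measure_display) (Omega : measurableType d)
    (R : realType) (P : probability Omega R) (k : nat)
    (calX : set (k.-tuple R)) (alpha : R)
    (H : nat -> bool)
    (p : nat -> {RV P >-> R}) (X : nat -> {RV P >-> k.-tuple R})
    (alpha01 : 0 < alpha < 1)
    (p01 : forall t w, 0 < p t w < 1)
    (X_calX : forall t w, calX (X t w))
    (p_null : superuniform_nulls p H)
    (p_indep : mutually_independent_pvalues p)
    (pX_indep : nulls_independent_of_others p X H)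
    (A : rule R k)
    (A_gai : contextual_gai p X calX alpha A)
    (A_mono : monotone_rule calX A) :
  (ereal_sup [set fdr p X A H T | T in [set: nat]] <= alpha%:E)%E.
Proof.
apply: ge_ereal_sup => _ [T _ <-].
have /andP[/ltW alpha_ge0 _] := alpha01.
apply: (fdr_le alpha_ge0 _ X_calX p_null pX_indep A_gai A_mono) => t w.
by have /andP[] := p01 t w.
Qed.
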